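(* Let $(X,\tau^{+},\tau^{-})$ be a bitopological space with $\tau^{+}=\tau^{-}$. Then for every $x\in X$ the symmetric component of $x$ and the antisymmetric component of $x$ coincide.
   Context: A bitopological space $(X,\tau^{+},\tau^{-})$ is a set with two topologies; $\tau^\vee=\tau^{+}\vee\tau^{-}$ denotes the join topology, i.e. the coarsest topology containing both. $(X,\tau^{+},\tau^{-})$ is antisymmetrically connected if there do not exist nonempty subsets $A,B\subseteq X$ with $X=A\cup B$, $A\cap B=\varnothing$, $A$ $\tau^{+}$-open and $B$ $\tau^{-}$-open. A subset $C\subseteq X$ is antisymmetrically connected if it is so with the subspace topologies induced by $\tau^{+}$ and $\tau^{-}$. The symmetric component of $x$ is the connected component of $x$ in $(X,\tau^\vee)$. The antisymmetric component of $x$ is the maximal antisymmetrically connected subset of $X$ containing $x$. *)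

(* Defs.v *)
From HB Require Import structures.
From mathcomp Require Import all_boot all_order all_classical.
From mathcomp Require Import topology.

Set Implicit Arguments.
Unset Strict Implicit.
Unset Printing Implicit Defensive.

Local Open Scope classical_set_scope.

(* [Topological T] is the type of topological structures on the carrier [T].
   The [choiceType] carrier is no restriction: every type is one classically. *)
Record bitopologicalType := Bitopological {
  carrier :> choiceType;
  plus_topology : Topological carrier;
  minus_topology : Topological carrier
}.

Section Bitopology.
Variable X : bitopologicalType.

Definition plus_space : topologicalType := Topological.Pack (plus_topology X).

Definition minus_space : topologicalType := Topological.Pack (minus_topology X).

Definition plus_open : set_system X := @open plus_space.

Definition minus_open : set_system X := @open minus_space.

Definition join_space : topologicalType :=
  sup_topology (fun b : bool => if b then plus_topology X else minus_topology X).

(* The subsets of [C] that are open in the subspace topology on [C] are the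
   traces [C `&` U] of open sets [U]; for [C = setT] this is antisymmetric
   connectedness of the whole space. *)
Definition antisym_connected (C : set X) : Prop :=
  ~ exists A B : set X,
    [/\ A !=set0, B !=set0, C = A `|` B & A `&` B = set0] /\
    (exists2 U, plus_open U & A = C `&` U) /\
    (exists2 V, minus_open V & B = C `&` V).

Definition symmetric_component (x : X) : set X :=
  @connected_component join_space setT x.

(* Maximality is with respect to inclusion. *)
Definition is_antisymmetric_component (x : X) (C : set X) : Prop :=
  [/\ C x, antisym_connected C &
      forall D : set X, D x -> antisym_connected D -> C `<=` D -> D = C].

End Bitopology.

Arguments plus_open : clear implicits.
Arguments minus_open : clear implicits.

(* Main.v *)
(* When the two topologies agree, their join is that same topology, so a
   separation of [C] by a plus-open and a minus-open trace is a separation of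
   [C] in the join, and the two notions of connectedness coincide.  A maximal
   connected set containing [x] is then the connected component of [x]. *)
Require Import Defs.
From HB Require Import structures.
From mathcomp Require Import all_boot all_order all_classical.
From mathcomp Require Import topology.

Local Open Scope classical_set_scope.

Section JoinTopology.
Variable X : bitopologicalType.

Let tau (b : bool) := if b then plus_topology X else minus_topology X.

(** The join-neighbourhood filter of [t] converges to [t] in the join, hence by [cvg_sup] in each of
    the two topologies. *)
Lemma plus_open_join (U : set X) : plus_open X U -> @open (join_space X) U.
Proof.
rewrite /plus_open !openE => oU t /oU.
have := cvg_sup tau t (nbhs_filter (t : join_space X)).
by move=> [/(_ cvg_id)/(_ true) + _]; apply.
Qed.

(** The plus-neighbourhood filter of [t] converges to [t] in both topologies, by [heq] in the minus
    one, hence in their supremum. *)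
Lemma join_plus_open (heq : plus_open X = minus_open X) (U : set X) :
  @open (join_space X) U -> plus_open X U.
Proof.
rewrite /plus_open !openE => oU t /oU.
apply: (cvg_sup tau t (nbhs_filter (t : plus_space X))).2.
case=> // A; rewrite (@nbhsE (minus_space X)) => -[B [oB Bt] BA].
rewrite /= (@nbhsE (plus_space X)); exists B => //; split=> //.
by change (plus_open X B); rewrite heq.
Qed.

Lemma antisym_connected_joinP (heq : plus_open X = minus_open X) (C : set X) :
  antisym_connected C <-> @connected (join_space X) C.
Proof.
split=> [acC B B0 [U oU BU] [F cF BF]|cC].
  (* A nonempty relatively clopen [B] other than [C] is separated from its complement in [C], the
     trace of the complement of [F]. *)
  apply: contrapT => BC; apply: acC; exists B, (C `&` ~` F); split; last first.
    split; first by exists U => //; exact: join_plus_open.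
    exists (~` F) => //; rewrite -heq; apply: join_plus_open => //.
    exact: closed_openC.
  split=> //.
  - apply/set0P/eqP => /disjoints_subset; rewrite setCK => CF.
    by apply: BC; rewrite BF; exact/setIidPl.
  - by rewrite BF -setIUr setUCr setIT.
  - by rewrite BF setIACA setICr setI0.
move=> [A [B [[A0 [b Bb] CAB AB0] [[U oU AU] [V oV BV]]]]].
suff eqAC : A = C.
  suff : (A `&` B) b by rewrite AB0.
  by split=> //; rewrite eqAC CAB; right.
apply: cC => //; first by exists U => //; exact: plus_open_join.
(* Since [B] is the trace of [V], [A] is also the trace of a closed set, so it is relatively
   clopen. *)
exists (~` V); first by apply/open_closedC/plus_open_join; rewrite heq.
apply/seteqP; split=> t.
  move=> At; have Ct : C t by rewrite CAB; left.
  split=> // Vt; have : (A `&` B) t by rewrite BV.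
  by rewrite AB0.
by move=> [Ct nVt]; have := Ct; rewrite {1}CAB BV => -[//|[]].
Qed.

End JoinTopology.

Theorem theorem5p7 (X : bitopologicalType)
    (heq : plus_open X = minus_open X) (x : X) (C : set X) :
  is_antisymmetric_component x C <-> C = symmetric_component x.
Proof.
have compx : symmetric_component x x.
  exact: (@connected_component_refl (join_space X) setT x).
have compc : antisym_connected (symmetric_component x).
  apply/antisym_connected_joinP => //.
  exact: (@component_connected (join_space X) setT x).
(* The component is thus greatest, not merely maximal, which makes the maximal set unique. *)
have compmax D : D x -> antisym_connected D -> D `<=` symmetric_component x.
  move=> Dx /(antisym_connected_joinP _ heq) cD.
  exact: (@connected_component_max (join_space X) setT D x).
split=> [[Cx cC maxC]|->].
  by apply/esym/maxC => //; exact: compmax.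
split=> // D Dx cD compD.
by apply/seteqP; split=> //; exact: compmax.
Qed.
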